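(* Let $n\ge 1$. For every $j=1,\ldots,n+1$, the number $v_j^n$ of non-crossing partitions with $n$ vertices (points in convex position) whose root vertex has isolation degree $j-1$ is $$v_{j}^{n} = \frac{j}{n+1}\sum_{k=\left\lceil\frac{n+j+1}{2}\right\rceil}^{n+1}\binom{n+1}{k}\binom{k-j-1}{2k-n-j-1}2^{2k-n-j-1}.$$
   Context: A partition of $[n]=\{1,\dots,n\}$ into nonempty, pairwise disjoint blocks is non-crossing if whenever $1\le a<b<c<d\le n$ are such that $a,c$ are in the same block and $b,d$ are in the same block, the two blocks coincide. A non-crossing partition is drawn as a plane geometric graph (straight-line edges that do not cross) on points $p_1,\dots,p_n$ in convex position labelled in counter-clockwise order: each block with at least three elements is drawn as the convex polygon (cycle) through its points, a block of size two as the edge joining its two points, and a block of size one as an isolated vertex. Two vertices are visible (from each other) if the line segment connecting them does not intersect the interior of any edge of the graph. The isolation degree of the root vertex $p_n$ is the number of isolated vertices (singleton blocks) that are visible from an additional vertex $p_{n+1}$ inserted between $p_n$ and $p_1$ in convex position. Binomial coefficients are generalized: $\binom{a}{m}=\frac{a(a-1)\cdots(a-m+1)}{m!}$ for any integer $a$ and integer $m\ge 0$; in particular $\binom{-1}{0}=1$. *)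

(* Defs.v *)
From HB Require Import structures.
From mathcomp Require Import all_boot all_order all_algebra.
From mathcomp Require Import boolp.

Set Implicit Arguments.
Unset Strict Implicit.
Unset Printing Implicit Defensive.

Import Order.TTheory GRing.Theory Num.Theory.
Local Open Scope ring_scope.

(* Labels are shifted by one: the vertex p_i, 1 <= i <= n, is the ordinal i - 1
   of 'I_n.  The plane is R^2 for an arbitrary ordered field R. *)

Section Plane.
Context {R : realFieldType}.
Implicit Types a b c x y z : 'rV[R]_2.

Definition segment a b z : Prop :=
  exists2 t : R, 0 <= t <= 1 & z = (1 - t) *: a + t *: b.

Definition open_segment a b z : Prop :=
  exists2 t : R, 0 < t < 1 & z = (1 - t) *: a + t *: b.

(* Positive iff a, b, c is a counter-clockwise triangle. *)
Definition orient a b c : R :=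
  (b 0 0 - a 0 0) * (c 0 1 - a 0 1) - (b 0 1 - a 0 1) * (c 0 0 - a 0 0).

Definition convex_position m (p : 'I_m -> 'rV[R]_2) : Prop :=
  forall (i : 'I_m) (w : 'I_m -> R),
    (forall k, 0 <= w k) -> w i = 0 -> \sum_k w k = 1 ->
    p i <> \sum_k w k *: p k.

(* For points in convex position, being labelled in counter-clockwise order
   means that all triples taken in increasing order turn left. *)
Definition ccw_labelled m (p : 'I_m -> 'rV[R]_2) : Prop :=
  forall i j k : 'I_m, (i < j)%N -> (j < k)%N -> 0 < orient (p i) (p j) (p k).

End Plane.

Definition noncrossing n (P : {set {set 'I_n}}) : bool :=
  [forall B in P, forall C in P,
     forall a in B, forall b in C, forall c in B, forall d in C,
       [&& a < b, b < c & c < d]%N ==> (B == C)].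

Definition noncrossing_partition n (P : {set {set 'I_n}}) : bool :=
  partition P [set: 'I_n] && noncrossing P.

(* [enum B] is increasing, so [next (enum B)] is the cyclic successor along the
   convex polygon through the points of B.  A block of size two yields its
   single edge (in both orientations), a singleton yields none. *)
Definition edge n (P : {set {set 'I_n}}) (a b : 'I_n) : bool :=
  [exists B in P, [&& a \in B, a != b & b == next (enum B) a]].

Definition visible (R : realFieldType) n (q : 'I_n -> 'rV[R]_2)
    (P : {set {set 'I_n}}) (x y : 'rV[R]_2) : Prop :=
  forall z, segment x y z ->
  forall a b : 'I_n, edge P a b -> ~ open_segment (q a) (q b) z.

(* The points p_1, ..., p_n and p_{n+1} are given together by p; the extra
   vertex p_{n+1} is [p ord_max]. *)
Definition isolation_degree (R : realFieldType) n (p : 'I_n.+1 -> 'rV[R]_2)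
    (P : {set {set 'I_n}}) : nat :=
  let q (i : 'I_n) := p (widen_ord (leqnSn n) i) in
  #|[set v : 'I_n | ([set v] \in P) && `[< visible q P (p ord_max) (q v) >]]|.

Definition num_isolation_degree (R : realFieldType) n
    (p : 'I_n.+1 -> 'rV[R]_2) (d : nat) : nat :=
  #|[set P : {set {set 'I_n}} |
      noncrossing_partition P && (isolation_degree p P == d)]|.

(* a (a - 1) ... (a - m + 1) / m! for any integer a. *)
Definition gbinomial (a : int) (m : nat) : rat :=
  (\prod_(i < m) (a - i%:Z))%:~R / m`!%:R.

(* Main.v *)
(* Extend the partition one point at a time and record the outer blocks (those
   under no other block), rightmost first, by a word whose letters tell singletons
   from larger blocks: a new point is either a new outer singleton or joins an
   outer block, which swallows all outer blocks to its right.  Let G(n, h, d) be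
   the number of partitions of n points with h marked outer blocks and exactly d
   outer singletons to the left of all marked ones.  Then
     G(n+1, h, d) = G(n, h+1, d) + 2 G(n, h, d) + G(n, h-1, d)    (h > 0)
     G(n+1, 0, d) = G(n, 1, d) + G(n, 0, d-1),
   so G counts Motzkin paths whose level steps have weight 2 off the ground.
   Lagrange inversion with phi(y) = (1 - y)^2 / (1 - 2y) = 1 + y^2 / (1 - 2y)
   gives G(n, h, d) as a coefficient of an explicit rational function, and
   expanding phi^(n+1) in powers of y^2 / (1 - 2y) gives the formula for h = 0.
   Geometrically, an isolated vertex v is hidden from p_(n+1) iff some block has
   points on both sides of v. *)

Require Import Defs.
From HB Require Import structures.
From mathcomp Require Import all_boot all_order all_algebra.
From mathcomp Require Import boolp.
From mathcomp Require Import zify ring.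

Set Implicit Arguments.
Unset Strict Implicit.
Unset Printing Implicit Defensive.

Import Order.TTheory GRing.Theory Num.Theory.
Local Open Scope ring_scope.

(** * Generalized binomial coefficients *)

Lemma gbinomial0 a : gbinomial a 0 = 1.
Proof. by rewrite /gbinomial big_ord0 fact0 divr1. Qed.

(** Pascal's rule for any integer [a]: without the common factors it reads (a + 1) - (a - m) = m +
    1. *)
Lemma gbinomialS a m :
  gbinomial (a + 1) m.+1 = gbinomial a m.+1 + gbinomial a m.
Proof.
rewrite /gbinomial big_ord_recl big_ord_recr /= subr0.
rewrite (eq_bigr (fun i : 'I_m => a - i%:Z)); last first.
  by move=> i _; rewrite /= /bump leq0n add1n intS; ring.
rewrite factS natrM !rmorphM /= !rmorphB /= !rmorphD /=.
have h1 : (m.+1%:R : rat) != 0 by rewrite pnatr_eq0.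
have h2 : (m`!%:R : rat) != 0 by rewrite pnatr_eq0 -lt0n fact_gt0.
have -> : (m%:Z%:~R : rat) = m.+1%:R - 1 by rewrite -natr1 addrK.
by field; rewrite h2 /= nat1r h1.
Qed.

Lemma gbinomial_pred m : gbinomial (m%:Z - 1) m = (m == 0)%:R.
Proof.
case: m => [|m]; first exact: gbinomial0.
by rewrite /gbinomial big_ord_recr /= intS addrC addKr subrr mulr0 mul0r.
Qed.

(** * Power series modulo X^K and Lagrange inversion *)

Section GeometricSeries.

Variable K : nat.

(* 1 / (1 - 2 X) modulo X^K. *)
Definition geom2 : {poly rat} := \sum_(i < K) (2%:R *: 'X) ^+ i.

Lemma geom2_mul : (1 - 2%:R *: 'X) * geom2 = 1 - 'X^K * (2%:R ^+ K)%:P.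
Proof.
rewrite -opprB mulNr -subrX1 opprB exprZn -mul_polyC; congr (_ - _).
exact: mulrC.
Qed.

(** Power series identities are proved as polynomial identities with an explicit multiple of X^K,
    invisible below degree K. *)
Lemma coefDXnM (p q r : {poly rat}) m :
  (m < K)%N -> p = q + 'X^K * r -> p`_m = q`_m.
Proof. by move=> mK ->; rewrite coefD coefXnM mK addr0. Qed.

Lemma coef_geom2_cancel (p : {poly rat}) a m : (m < K)%N ->
  (p * (1 - 2%:R *: 'X) * geom2 ^+ a.+1)`_m = (p * geom2 ^+ a)`_m.
Proof.
move=> mK.
apply: (@coefDXnM _ _ (- (2%:R ^+ K)%:P * p * geom2 ^+ a)) => //.
rewrite exprS.
rewrite [LHS](_ : _ = p * geom2 ^+ a * ((1 - 2%:R *: 'X) * geom2)); last by ring.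
by rewrite geom2_mul; ring.
Qed.

(** Negative binomial series: with g = [geom2], the relation g^(a+1) = g^a + 2 X g^(a+1) modulo X^K
    becomes Pascal's rule. *)
Lemma coef_geom2X a m : (m < K)%N ->
  (geom2 ^+ a)`_m = gbinomial (a%:Z + m%:Z - 1) m * 2%:R ^+ m.
Proof.
elim: a m => [|a IHa] m mK.
  by rewrite expr0 coef1 add0r gbinomial_pred; case: m mK => [|m] _;
    rewrite ?mul1r ?mul0r ?expr0.
have E k : (k < K)%N -> (geom2 ^+ a.+1)`_k =
    (geom2 ^+ a)`_k + 2%:R * (geom2 ^+ a.+1 * 'X)`_k.
  move=> kK; rewrite -[geom2 ^+ a]mul1r -(coef_geom2_cancel 1 a kK) mul1r.
  have {1}-> : geom2 ^+ a.+1 = (1 - 2%:R *: 'X) * geom2 ^+ a.+1 +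
      2%:R *: (geom2 ^+ a.+1 * 'X) by rewrite -!mul_polyC; ring.
  by rewrite coefD coefZ.
elim: m mK => [|m IHm] mK; rewrite E //.
  by rewrite coefMX /= mulr0 addr0 IHa // !gbinomial0.
rewrite coefMX /= IHa // IHm ?(ltn_trans _ mK) //.
rewrite [a.+1%:Z + m.+1%:Z - 1](_ : _ = (a%:Z + m.+1%:Z - 1) + 1); last by lia.
rewrite gbinomialS [a.+1%:Z + m%:Z - 1](_ : _ = a%:Z + m.+1%:Z - 1); last by lia.
by rewrite exprS; ring.
Qed.

(** For g = 1 / (1 - 2X) one has g' = 2 g^2; the factor X keeps the derivative of X^K a multiple of
    X^K. *)
Lemma deriv_geom2 :
  exists r, geom2^`() * 'X = 2%:R *: (geom2 ^+ 2 * 'X) + 'X^K * r.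
Proof.
have XXn : ('X^K)^`() * 'X = K%:R *: 'X^K :> {poly rat}.
  case: K => [|k]; first by rewrite expr0 derivC mul0r scale0r.
  by rewrite derivXn mulrnAl -exprSr scaler_nat.
have := congr1 (fun q => q^`() * 'X) geom2_mul.
rewrite /= derivM !derivB derivZ derivX derivM !derivC mulr0 addr0 !sub0r.
have -> (x : {poly rat}) : - (('X^K)^`() * x) * 'X = - (('X^K)^`() * 'X * x) by ring.
rewrite XXn; have := geom2_mul.
rewrite -!mul_polyC mulr1; set g := geom2; set c := (2 ^+ K)%:P.
(* The relation (1 - 2X) g = 1 - c X^K is differentiated and multiplied by X g; its terms in X^K
   give the witness. *)
move=> E1 E2; exists (c * g^`() * 'X - K%:R%:P * c * g).
apply: subr0_eq.
transitivity (g^`() * 'X * (1 - 'X^K * c) - 2%:R%:P * (g ^+ 2 * 'X)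
   + g * (K%:R%:P * 'X^K * c)); first by ring.
rewrite -E1 -[X in g * X]opprK -E2; ring.
Qed.

(* With phi = (1 - X)^2 / (1 - 2 X), the left-hand side is a coefficient of
   (n + 1) phi^n (phi - X phi'), i.e. of (n + 1) phi^(n+1) - X (phi^(n+1))'. *)
Lemma coef_geom2_lagrange n m : (m < K)%N ->
  n.+1%:R * ((1 - 'X) ^+ (2 * n).+1 * (1 - 3%:R *: 'X) * geom2 ^+ n.+2)`_m
  = (n.+1%:R - m%:R) * ((1 - 'X) ^+ (2 * n).+2 * geom2 ^+ n.+1)`_m.
Proof.
move=> mK; set f := (1 - 'X) ^+ (2 * n).+2 * geom2 ^+ n.+1.
rewrite mulrBl.
have -> : m%:R * f`_m = (f^`() * 'X)`_m.
  by rewrite coefMX coef_deriv; case: m {mK} => [|m]; rewrite ?mul0r ?mulr_natl.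
rewrite -!coefZ -coefB.
have [r Er] := deriv_geom2.
(* The truncation errors of [geom2_mul] and [deriv_geom2] are collected here. *)
pose r' := - n.+1%:R%:P * (1 - 'X) ^+ (2 * n).+1 * geom2 ^+ n *
  (geom2 * (1 + 'X) * (2%:R ^+ K)%:P - (1 - 'X) * r).
apply: (@coefDXnM _ _ r') => //.
rewrite {}/r' {}/f derivM !deriv_exp derivB derivX derivC sub0r /=.
rewrite mulrDl -(mulr_natl (geom2^`() * _)) -(mulr_natl (-1 * _)).
have -> : (1 - 'X) ^+ (2 * n).+2 * (n.+1%:R * (geom2^`() * geom2 ^+ n)) * 'X
  = (1 - 'X) ^+ (2 * n).+2 * n.+1%:R * geom2 ^+ n * (geom2^`() * 'X) by ring.
rewrite Er -!mul_polyC.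
have := geom2_mul; rewrite -!mul_polyC !exprS.
set U := (1 - 'X) ^+ (2 * n); set I := geom2 ^+ n; set g := geom2.
set c := (2 ^+ K)%:P => E1; apply: subr0_eq.
transitivity (n.+1%:R%:P * (1 - 'X) * U * I * g * (1 + 'X) *
    ((1 - 2%:R%:P * 'X) * g - (1 - 'X^K * c))); last by rewrite E1 subrr mulr0.
have -> : (2 * n).+2%:R = 2%:R * n.+1%:R :> {poly rat}.
  by rewrite -natrM mulnS add2n.
ring.
Qed.

(* Let F and D be the generating functions of the Motzkin paths from the ground to
   the ground without level steps on the ground, and of the descents by one level.
   The paths from height h to the ground with d level steps on the ground have
   generating function z^d F^(d+1) D^h, where z F = y, D = y / (1 - 2y) and
   z = y / phi(y); Lagrange inversion yields this coefficient of y^n. *)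
Definition motzkin_coef n h d :=
  ('X^(d + h) * (1 - 'X) ^+ (2 * n).+1 * (1 - 3%:R *: 'X)
    * geom2 ^+ (n + h).+2)`_n.

(** * Recurrences and explicit form of the path coefficients *)

Lemma coef_geom2_cancelX (p : {poly rat}) a i m : (m < K)%N ->
  (p * (1 - 2%:R *: 'X) ^+ i * geom2 ^+ (i + a))`_m = (p * geom2 ^+ a)`_m.
Proof.
move=> mK; elim: i => [|i IHi]; first by rewrite mulr1.
by rewrite exprSr mulrA coef_geom2_cancel.
Qed.

(** Multiplying by X and inserting [i] factors (1 - 2X) g brings all terms of a recurrence to one
    degree and one power of g, so that only polynomials remain to be compared. *)
Lemma motzkin_coef_shift i n h d : (n.+1 < K)%N ->
  motzkin_coef n h d = ('X^((d + h).+1) * (1 - 'X) ^+ (2 * n).+1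
    * (1 - 3%:R *: 'X) * (1 - 2%:R *: 'X) ^+ i * geom2 ^+ (i + (n + h).+2))`_n.+1.
Proof.
move=> nK; rewrite coef_geom2_cancelX // exprS -3!mulrA coefXM /=.
by rewrite /motzkin_coef !mulrA.
Qed.

(** Up to common factors this is (1 - X)^2 = (X + (1 - 2X))^2, expanded. *)
Lemma motzkin_coefSS n h d : (n.+1 < K)%N ->
  motzkin_coef n.+1 h.+1 d = motzkin_coef n h.+2 d +
    2%:R * motzkin_coef n h.+1 d + motzkin_coef n h d.
Proof.
move=> nK; rewrite (@motzkin_coef_shift 0 n h.+2) //.
rewrite (@motzkin_coef_shift 1 n h.+1) // (@motzkin_coef_shift 2 n h) //.
rewrite /motzkin_coef !add2n add0n add1n !addnS !addSn mulnS !add2n.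
rewrite -coefZ -!coefD; congr (polyseq _)`_ _; rewrite -!mul_polyC !exprS; ring.
Qed.

(** Up to common factors this is (1 - X)^2 = X^2 + (1 - 2X). *)
Lemma motzkin_coefS0S n d : (n.+1 < K)%N ->
  motzkin_coef n.+1 0 d.+1 = motzkin_coef n 1 d.+1 + motzkin_coef n 0 d.
Proof.
move=> nK; rewrite (@motzkin_coef_shift 0 n 1) // (@motzkin_coef_shift 1 n 0) //.
rewrite /motzkin_coef !addnS !addn0 mulnS !add2n !add0n !add1n.
rewrite -coefD; congr (polyseq _)`_ _; rewrite -!mul_polyC !exprS; ring.
Qed.

(** The term 1 - 2X now has to contribute 0: it gives the left-hand side of [coef_geom2_lagrange] at
    m = n + 1, where n + 1 - m = 0. *)
Lemma motzkin_coefS00 n : (n.+1 < K)%N ->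
  motzkin_coef n.+1 0 0 = motzkin_coef n 1 0.
Proof.
move=> nK; apply/eqP; rewrite -subr_eq0; apply/eqP.
rewrite (@motzkin_coef_shift 0 n 1) //.
have := coef_geom2_lagrange n nK; rewrite subrr mul0r.
move/eqP; rewrite mulf_eq0 pnatr_eq0 /= => /eqP E0; rewrite -[RHS]E0.
rewrite -(coef_geom2_cancel _ n.+2) // /motzkin_coef.
rewrite !addnS !addn0 mulnS !add2n !add0n.
rewrite -coefB; congr (polyseq _)`_ _; rewrite -!mul_polyC !exprS; ring.
Qed.

Lemma motzkin_coef0 h d : (0 < K)%N ->
  motzkin_coef 0 h d = ((h == 0) && (d == 0))%:R.
Proof.
move=> K0; rewrite /motzkin_coef muln0 expr1; move: (0 + h).+2 => a.
rewrite !coef0M coef_geom2X // gbinomial0 coefXn !coefB !coef1 coefZ.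
rewrite !coefX /= expr0 mulr0 !subr0 !mulr1.
by case: d h => [|d] [|h].
Qed.

(** Lagrange's factor n + 1 - m is j + 1 for m = n - j; then phi^(n+1) = (1 + X^2 g)^(n+1) is
    expanded. *)
Lemma motzkin_coef_binomial n j : (n.+2 <= K)%N -> (j <= n)%N ->
  motzkin_coef n 0 j = j.+1%:R / n.+1%:R *
    \sum_(i < n.+2) 'C(n.+1, i)%:R *
      ((2 * i <= n - j)%N)%:R * (geom2 ^+ i)`_(n - j - 2 * i).
Proof.
move=> nK jn; rewrite /motzkin_coef addn0 -!mulrA coefXnM ltnNge jn /=.
set m := (n - j)%N; have mK : (m < K)%N by lia.
have n0 : n.+1%:R != 0 :> rat by rewrite pnatr_eq0.
apply: (mulfI n0); rewrite [RHS]mulrCA mulVKf //.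
rewrite addn0 [(1 - 'X) ^+ _ * _]mulrA coef_geom2_lagrange //.
have -> : n.+1%:R - m%:R = j.+1%:R :> rat by rewrite -natrB; [congr _%:R|]; lia.
congr (_ * _).
have := geom2_mul; set c := (2 ^+ K)%:P => E1.
transitivity (((1 + 'X^2 * geom2) ^+ n.+1)`_m).
  have E2 : (1 - 'X) ^+ 2 * geom2 = 1 + 'X^2 * geom2 - 'X^K * c.
    rewrite -[_ - 'X^K * c]addrAC -E1 -!mul_polyC; ring.
  rewrite -[(2 * n).+2](mulnS 2 n) exprM -exprMn.
  (* A difference of powers is a multiple of the difference of the bases, here a multiple of X^K. *)
  have := subrXX ((1 - 'X) ^+ 2 * geom2) (1 + 'X^2 * geom2) n.+1.
  move/(canRL (subrK _)) => ->; rewrite coefD {1}E2 [X in X * _]addrAC subrr add0r.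
  by rewrite mulNr coefN -mulrA coefXnM mK oppr0 add0r.
rewrite exprDn coef_sum; apply: eq_bigr => i _.
rewrite expr1n mul1r coefMn exprMn -exprM coefXnM -mulrA.
rewrite -(mulr_natl (if _ then _ else _)) [(2 * i <= m)%N]leqNgt.
by case: (m < 2 * i)%N; rewrite /= ?mul1r ?mul0r.
Qed.

Lemma motzkin_coef_explicit n j : (n.+2 <= K)%N -> (1 <= j <= n.+1)%N ->
  motzkin_coef n 0 (j - 1) = j%:R / n.+1%:R *
    \sum_(uphalf (n + j + 1) <= k < n.+2)
      'C(n.+1, k)%:R * gbinomial (k%:Z - j%:Z - 1) (2 * k - n - j - 1)
        * 2%:R ^+ (2 * k - n - j - 1).
Proof.
case: j => // j nK jn; rewrite subn1 /= motzkin_coef_binomial //; congr (_ * _).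
rewrite -(big_mkord xpredT (fun i => 'C(n.+1, i)%:R *
      ((2 * i <= n - j)%N)%:R * (geom2 ^+ i)`_(n - j - 2 * i))).
(* Substitution k = n + 1 - i. [uphalf] is the ceiling of the half; the terms below this bound have
   2 i > n - j (with [j] already lowered by one) and vanish. *)
rewrite big_nat_rev /= (big_cat_nat (n := uphalf (n + j.+1 + 1))) //=; last first.
  by rewrite uphalf_half; lia.
rewrite [X in X + _]big_nat_cond big1 ?add0r => [|k].
  apply: eq_big_nat => k kn.
  have -> : (0 + n.+2 - k.+1 = n.+1 - k)%N by lia.
  have kj : (n + j.+1 + 1 <= 2 * k)%N by move: kn; rewrite uphalf_half; lia.
  have -> : (2 * (n.+1 - k) <= n - j)%N by lia.
  rewrite mulr1 bin_sub ?coef_geom2X -?[RHS]mulrA; try lia.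
  have -> : (n - j - 2 * (n.+1 - k) = 2 * k - n - j.+1 - 1)%N by lia.
  by congr (_ * (gbinomial _ _ * _)); lia.
rewrite andbT uphalf_half => kn.
have -> : (2 * (0 + n.+2 - k.+1) <= n - j)%N = false by lia.
by rewrite mulr0 mul0r.
Qed.

End GeometricSeries.

(** * Words of outer blocks *)

Fixpoint proper_tails T (s : seq T) : seq (seq T) :=
  if s is _ :: t then t :: proper_tails t else [::].

Lemma proper_tails_map T U (f : T -> U) s :
  proper_tails (map f s) = map (map f) (proper_tails s).
Proof. by elim: s => //= x s ->. Qed.

Lemma gtn_trans : transitive gtn.
Proof. by move=> a b c /= ba ac; exact: ltn_trans ac ba. Qed.

Lemma proper_tails_filter (s : seq nat) : sorted gtn s ->
  [seq [seq m <- s | m < x]%N | x <- s] = proper_tails s.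
Proof.
elim: s => //= x s IHs /[dup] /path_sorted /IHs <-.
rewrite ltnn (path_sortedE gtn_trans).
case/andP => /allP xs _; congr (_ :: _).
  by apply/all_filterP/allP.
by apply/eq_in_map => y /xs /= yx; rewrite ltnNge ltnW.
Qed.

Lemma filter_leq_gtn_sorted (s : seq nat) x : sorted gtn s -> x \in s ->
  [seq m <- s | m <= x]%N = x :: [seq m <- s | m < x]%N.
Proof.
move=> ss xs; apply: (@irr_sorted_eq _ gtn) => //.
- exact: gtn_trans.
- by move=> a; rewrite /= ltnn.
- by apply: sorted_filter => //; exact: gtn_trans.
- rewrite /= (path_sortedE gtn_trans).
  rewrite filter_all sorted_filter //; exact: gtn_trans.
- move=> a; rewrite inE !mem_filter leq_eqVlt.
  by case: eqVneq => [->|_] //; rewrite xs.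
Qed.

(** The first word adds an outer singleton. In the others the new point joins the block whose letter
    precedes [t]; that letter becomes [false] and all blocks to its right are swallowed. *)
Definition children (w : seq bool) : seq (seq bool) :=
  (true :: w) :: [seq false :: t | t <- proper_tails w].

Fixpoint words n : seq (seq bool) :=
  if n is m.+1 then flatten [seq children w | w <- words m] else [:: [::]].

(* Words are read from the rightmost outer block on, and true stands for a
   singleton: the choices of h letters of w, the last of them followed by exactly
   d letters true. *)
Fixpoint marked h d (w : seq bool) : nat :=
  if h is h'.+1 then \sum_(t <- proper_tails w) marked h' d t
  else count_mem true w == d.

(** The new first letter is marked or not; in [false :: t] the letter of [w] before [t] acts as one
    more mark in [w]. *)
Lemma marked_childrenS h d w :
  (\sum_(c <- children w) marked h.+1 d c =
   marked h.+2 d w + (marked h.+1 d w + marked h.+1 d w) + marked h d w)%N.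
Proof.
have mS x t : marked h.+1 d (x :: t) = (marked h d t + marked h.+1 d t)%N.
  by rewrite /= big_cons.
rewrite big_cons big_map mS (eq_bigr _ (fun t _ => mS false t)) big_split.
by rewrite /=; lia.
Qed.

Lemma marked_children0 d w :
  (\sum_(c <- children w) marked 0 d c =
   marked 1 d w + if d is d'.+1 then marked 0 d' w else 0)%N.
Proof.
rewrite big_cons big_map /= addnC add1n; congr (_ + _)%N.
by case: d => [|d]; rewrite ?eqSS.
Qed.

Lemma sum_words n h d : (\sum_(w <- words n.+1) marked h d w =
  \sum_(w <- words n) \sum_(c <- children w) marked h d c)%N.
Proof. by rewrite /= big_flatten big_map. Qed.

Lemma sum_marked_words K n h d : (n < K)%N ->
  (\sum_(w <- words n) marked h d w)%:R = motzkin_coef K n h d.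
Proof.
elim: n h d => [|n IHn] h d nK.
  rewrite motzkin_coef0 // big_seq1; case: h => [|h] /=; last by rewrite big_nil.
  by rewrite eq_sym.
have nK' := ltnW nK; rewrite sum_words; case: h => [|h].
  under eq_bigr => w _ do rewrite marked_children0.
  rewrite big_split natrD IHn //; case: d => [|d] /=; last first.
    by rewrite (IHn 0) // motzkin_coefS0S.
  by rewrite big1 // addr0 motzkin_coefS00.
under eq_bigr => w _ do rewrite marked_childrenS.
by rewrite !big_split !natrD !IHn // motzkin_coefSS // mulr_natl mulr2n.
Qed.

(** * Canonical sequences of block minima *)

(* A partition of {0, ..., n-1} is encoded by the sequence s of length n whose
   entry s_i is the least element of the block of i; a block is named by its least
   element m. *)
Definition outer (s : seq nat) (m : nat) : bool :=
  [&& m < size s, nth 0 s m == m & all (leq m) (drop m s)]%N.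

Definition outers (s : seq nat) : seq nat :=
  [seq m <- rev (iota 0 (size s)) | outer s m].

Definition lone (s : seq nat) (m : nat) : bool := m \notin drop m.+1 s.

Definition outer_word (s : seq nat) : seq bool := [seq lone s m | m <- outers s].

Definition extensions (s : seq nat) : seq (seq nat) :=
  [seq rcons s x | x <- size s :: outers s].

Fixpoint ncseqs n : seq (seq nat) :=
  if n is m.+1 then [seq rcons s x | s <- ncseqs m, x <- size s :: outers s]
  else [:: [::]].

Lemma outers_sorted s : sorted gtn (outers s).
Proof.
apply: sorted_filter; first exact: gtn_trans.
by rewrite rev_sorted; exact: iota_ltn_sorted.
Qed.

Lemma mem_outers s m : (m \in outers s) = outer s m.
Proof.
rewrite mem_filter mem_rev mem_iota /= add0n andbC.
by rewrite /outer; case: (m < size s)%N.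
Qed.

Lemma outer_rcons s x m : (m < size s)%N ->
  outer (rcons s x) m = outer s m && (m <= x)%N.
Proof.
move=> ms; rewrite /outer size_rcons ltnS ltnW // ms nth_rcons ms.
rewrite drop_rcons ?(ltnW ms) // all_rcons /=.
by case: (m <= x)%N; rewrite ?andbT ?andbF.
Qed.

Lemma outers_rcons s x : outers (rcons s x) =
  if x == size s then size s :: outers s else [seq m <- outers s | m <= x]%N.
Proof.
rewrite /outers size_rcons -addn1 iotaD rev_cat /= add0n {1}/outer.
rewrite size_rcons leqnn nth_rcons ltnn eqxx drop_rcons // drop_size /= andbT.
rewrite -filter_predI; case: eqP => [->|ne] /=.
  rewrite leqnn; congr (_ :: _); apply: eq_in_filter => m.
  rewrite mem_rev mem_iota /= add0n => ms.
  by rewrite outer_rcons // (ltnW ms) andbT.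
apply: eq_in_filter => m; rewrite mem_rev mem_iota /= add0n => ms.
by rewrite outer_rcons // andbC.
Qed.

Lemma lone_rcons s x m : (m < size s)%N ->
  lone (rcons s x) m = (m != x) && lone s m.
Proof. by move=> ms; rewrite /lone drop_rcons // mem_rcons inE negb_or. Qed.

Lemma outer_lt s m : m \in outers s -> (m < size s)%N.
Proof. by rewrite mem_outers => /and3P[]. Qed.

Lemma outer_word_extensions s :
  map outer_word (extensions s) = children (outer_word s).
Proof.
rewrite /extensions /children /= -map_comp; congr (_ :: _).
  rewrite /outer_word outers_rcons eqxx /= /lone drop_oversize ?size_rcons //=.
  congr (_ :: _); apply/eq_in_map => m /outer_lt ms.
  by rewrite -!/(lone _ _) lone_rcons // (ltn_eqF ms).
(* Joining [x] keeps the outer names up to [x]; the names below [x] form the tail after [x] in the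
   decreasing list. *)
rewrite /outer_word proper_tails_map -proper_tails_filter ?outers_sorted //.
rewrite -!map_comp; apply/eq_in_map => x xs /=.
have xlt := outer_lt xs.
rewrite outers_rcons (ltn_eqF xlt) filter_leq_gtn_sorted ?outers_sorted //=.
rewrite lone_rcons // eqxx; congr (_ :: _); apply/eq_in_map => m.
by rewrite mem_filter => /andP[mx /outer_lt ms]; rewrite lone_rcons // (ltn_eqF mx).
Qed.

Lemma map_outer_word_ncseqs n : map outer_word (ncseqs n) = words n.
Proof.
elim: n => //= n <-; rewrite map_flatten -!map_comp; congr flatten.
by apply: eq_map => s /=; exact: outer_word_extensions.
Qed.

Lemma uniq_ncseqs n : uniq (ncseqs n).
Proof.
elim: n => [|n IHn]; [by []|apply: allpairs_uniq_dep => //].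
  move=> s _ /=; rewrite filter_uniq ?rev_uniq ?iota_uniq // andbT.
  by apply/negP => /outer_lt; rewrite ltnn.
by case=> [s x] [t y] _ _ /= /rcons_inj [-> ->].
Qed.

(** The third condition rules out the crossing s_b < s_i < b < i. *)
Definition canonical_nc (s : seq nat) : Prop :=
  forall i, (i < size s)%N ->
    [/\ (nth 0 s i <= i)%N, nth 0 s (nth 0 s i) = nth 0 s i &
        forall b, (nth 0 s i <= b <= i)%N -> (nth 0 s i <= nth 0 s b)%N].

Lemma outerP s m :
  reflect [/\ (m < size s)%N, nth 0 s m = m &
    forall b, (m <= b < size s)%N -> (m <= nth 0 s b)%N] (outer s m).
Proof.
apply: (iffP and3P) => [[ms /eqP sm /(all_nthP 0) H]|[ms sm H]]; split=> //.
- move=> b /andP[mb bs]; have := H (b - m)%N.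
  by rewrite size_drop nth_drop ltn_sub2r ?subnKC // => ->.
- exact/eqP.
- apply/(all_nthP 0) => i; rewrite size_drop nth_drop => i_lt.
  by apply: H; lia.
Qed.

(** The conditions at [i] involve entries up to [i] only; at the last position they say that [x] is
    a fresh or an outer name. *)
Lemma canonical_nc_rcons s x : canonical_nc (rcons s x) <->
  canonical_nc s /\ (x = size s \/ outer s x).
Proof.
split=> [H|[H Hx] i].
  split=> [i i_lt|].
    have [] := H i; first by rewrite size_rcons ltnW.
    rewrite nth_rcons i_lt => h1; rewrite nth_rcons (leq_ltn_trans h1) // => h2 h3.
    split=> // b bi; have := h3 b bi; rewrite nth_rcons.
    by have -> : (b < size s)%N by lia.
  have [] := H (size s); first by rewrite size_rcons.
  rewrite nth_rcons ltnn eqxx leq_eqVlt => /orP[/eqP ->|xs]; first by left.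
  rewrite nth_rcons xs => sx h; right; apply/outerP; split=> // b /andP[xb bs].
  by have := h b; rewrite nth_rcons bs xb ltnW //; apply.
rewrite size_rcons ltnS leq_eqVlt => /orP[/eqP ->|i_lt].
  rewrite (nth_rcons _ s x (size s)) ltnn eqxx.
  case: Hx => [->|/outerP[xs sx h]].
    rewrite nth_rcons ltnn eqxx; split=> // b bs.
    by rewrite -(anti_leq bs) nth_rcons ltnn eqxx.
  rewrite nth_rcons xs; split=> //; first exact: ltnW.
  move=> b /andP[xb]; rewrite leq_eqVlt => /orP[/eqP ->|bs].
    by rewrite nth_rcons ltnn eqxx.
  by rewrite nth_rcons bs; apply: h; rewrite xb.
have [h1 h2 h3] := H i i_lt.
rewrite (nth_rcons _ s x i) i_lt; split=> //.
  by rewrite nth_rcons (leq_ltn_trans h1).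
move=> b bi; rewrite nth_rcons; have -> : (b < size s)%N by lia.
exact: h3.
Qed.

Lemma ncseqsP n s : s \in ncseqs n <-> size s = n /\ canonical_nc s.
Proof.
elim: n s => [|n IHn] s.
  by rewrite /= inE; split=> [/eqP ->|[/size0nil ->]].
split.
  case/allpairsPdep => t [x] [/IHn [st vt]]; rewrite inE mem_outers => Hx ->.
  rewrite size_rcons st; split=> //; apply/canonical_nc_rcons; split=> //.
  by case/orP: Hx => [/eqP ->|]; [left|right].
case; case/lastP: s => [//|t x]; rewrite size_rcons => -[st].
case/canonical_nc_rcons => vt Hx; apply/allpairsPdep; exists t, x.
split=> //; first by apply/IHn.
by rewrite inE mem_outers; apply/orP; case: Hx => [->|]; [left|right].
Qed.

(** * Bijection of canonical sequences with non-crossing partitions *)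

Definition level_partition n (s : seq nat) : {set {set 'I_n}} :=
  preim_partition (fun i : 'I_n => nth 0 s i) [set: 'I_n].

Lemma mem_level_pblock n s (i j : 'I_n) :
  (j \in pblock (level_partition n s) i) = (nth 0 s i == nth 0 s j).
Proof.
rewrite /level_partition /preim_partition.
by rewrite pblock_equivalence_partition ?inE // => x y z; split=> // /eqP ->.
Qed.

Lemma level_partitionP n s : partition (level_partition n s) [set: 'I_n].
Proof. exact: preim_partitionP. Qed.

Lemma noncrossing_pblockP n (P : {set {set 'I_n}}) :
  partition P [set: 'I_n] ->
  reflect (forall a b c d : 'I_n, (a < b)%N -> (b < c)%N -> (c < d)%N ->
      c \in pblock P a -> d \in pblock P b -> pblock P a = pblock P b)
    (noncrossing P).
Proof.
case/and3P => /eqP covP tiP _.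
have inP (x : 'I_n) : x \in cover P by rewrite covP in_setT.
apply: (iffP idP) => [H a b c d ab bc cd ac bd | H].
  move/forall_inP: H => /(_ _ (pblock_mem (inP a)))/forall_inP.
  move/(_ _ (pblock_mem (inP b)))/forall_inP/(_ a).
  rewrite mem_pblock inP => /(_ isT)/forall_inP/(_ b).
  rewrite mem_pblock inP => /(_ isT)/forall_inP/(_ c ac)/forall_inP/(_ d bd).
  by rewrite ab bc cd => /eqP.
apply/forall_inP => B PB; apply/forall_inP => C PC.
apply/forall_inP => a Ba; apply/forall_inP => b Cb.
apply/forall_inP => c Bc; apply/forall_inP => d Cd.
apply/implyP => /and3P[ab bc cd].
rewrite -(def_pblock tiP PB Ba) -(def_pblock tiP PC Cb); apply/eqP.
by apply: (H a b c d) => //; rewrite ?(def_pblock tiP PB Ba) ?(def_pblock tiP PC Cb).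
Qed.

Lemma level_partition_nc n s : size s = n -> canonical_nc s ->
  noncrossing_partition (level_partition n s).
Proof.
move=> sn vs; have lP := level_partitionP n s.
apply/andP; split=> //; apply/noncrossing_pblockP => // a b c d ab bc cd.
rewrite !mem_level_pblock => /eqP ac /eqP bd; apply/eqP.
have /and3P[/eqP covP tiP _] := lP.
rewrite eq_pblock ?covP ?in_setT //.
rewrite mem_level_pblock eqn_leq.
have [c1 _ c3] := vs c (leq_trans (ltn_ord c) (eq_leq (esym sn))).
have [d1 _ d3] := vs d (leq_trans (ltn_ord d) (eq_leq (esym sn))).
have [a1 _ _] := vs a (leq_trans (ltn_ord a) (eq_leq (esym sn))).
have [b1 _ _] := vs b (leq_trans (ltn_ord b) (eq_leq (esym sn))).
(* The third condition at [c], used for [b], gives s_a <= s_b; at [d], used for [c], it gives s_b <=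
   s_a. *)
apply/andP; split.
  by rewrite ac; apply: c3; rewrite -ac (ltnW bc) (leq_trans a1 (ltnW ab)).
by rewrite bd ac; apply: d3; rewrite -bd (ltnW cd) (leq_trans b1 (ltnW bc)).
Qed.

Lemma level_partition_inj n s t : size s = n -> canonical_nc s ->
  size t = n -> canonical_nc t ->
  level_partition n s = level_partition n t -> s = t.
Proof.
wlog suff: s t / size s = n -> canonical_nc s -> size t = n -> canonical_nc t ->
    level_partition n s = level_partition n t ->
    forall i, (i < n)%N -> (nth 0 s i <= nth 0 t i)%N.
  move=> H sn vs tn vt E; apply: (@eq_from_nth _ 0); first by rewrite sn tn.
  by move=> i; rewrite sn => i_n; apply/eqP; rewrite eqn_leq !H.
move=> sn vs tn vt E i i_n.
have [t1 t2 _] := vt i (leq_trans i_n (eq_leq (esym tn))).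
have x_n := leq_ltn_trans t1 i_n.
(* In [t] the point x = t_i is in the block of i, hence also in [s], and s_i = s_x <= x. *)
have := mem_level_pblock s (Ordinal i_n) (Ordinal x_n).
rewrite E mem_level_pblock /= t2 eqxx => /esym/eqP ->.
by have [] := vs _ (leq_trans x_n (eq_leq (esym sn))).
Qed.

Section MinLabels.

Variables (n : nat) (P : {set {set 'I_n}}).
Hypothesis ncP : noncrossing_partition P.

Definition block_min (i : 'I_n) : 'I_n := [arg min_(x < i in pblock P i) (x : nat)].

Definition min_labels : seq nat := [seq nat_of_ord (block_min i) | i <- enum 'I_n].

Lemma size_min_labels : size min_labels = n.
Proof. by rewrite size_map size_enum_ord. Qed.

Lemma nth_min_labels (i : 'I_n) : nth 0 min_labels i = block_min i.
Proof. by rewrite (nth_map i) ?size_enum_ord // nth_ord_enum. Qed.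

Let partP : partition P [set: 'I_n]. Proof. by case/andP: ncP. Qed.
Let tiP : trivIset P. Proof. by case/and3P: partP. Qed.
Let coverP i : i \in cover P.
Proof. by case/and3P: partP => /eqP -> _ _; rewrite in_setT. Qed.

Lemma block_minP i : block_min i \in pblock P i /\
  forall j, j \in pblock P i -> (block_min i <= j)%N.
Proof.
by rewrite /block_min; case: arg_minnP => [|x xi H]; rewrite ?mem_pblock.
Qed.

Lemma block_min_eq i j : (block_min i == block_min j) = (pblock P i == pblock P j).
Proof.
have [mi mini] := block_minP i; have [mj minj] := block_minP j.
apply/eqP/eqP => [E|E].
  by rewrite -(same_pblock tiP mi) -(same_pblock tiP mj) E.
apply/val_inj/eqP; rewrite eqn_leq /=.
by rewrite mini ?E // minj // -E.
Qed.

Lemma level_partition_min_labels : level_partition n min_labels = P.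
Proof.
rewrite -[RHS](preim_partition_pblock partP).
apply: eq_imset => i; apply/setP => j; rewrite !inE !nth_min_labels.
by rewrite -block_min_eq.
Qed.

Lemma canonical_min_labels : canonical_nc min_labels.
Proof.
move=> i; rewrite size_min_labels => i_n.
have -> : nth 0 min_labels i = block_min (Ordinal i_n) by rewrite -nth_min_labels.
set j := Ordinal i_n; have [mj minj] := block_minP j.
have mm : block_min (block_min j) = block_min j.
  by apply/eqP; rewrite block_min_eq (same_pblock tiP mj).
have mij : (block_min j <= i)%N by apply: (minj j); rewrite mem_pblock.
split=> //; first by rewrite nth_min_labels mm.
move=> b /andP[jb bi]; have b_n := leq_ltn_trans bi i_n.
rewrite (nth_min_labels (Ordinal b_n)); set k := Ordinal b_n.
have [mk mink] := block_minP k.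
(* Otherwise min k < min j < k < j would be a crossing. *)
rewrite leqNgt; apply/negP => kj.
have ne : block_min k != block_min j by rewrite neq_ltn kj.
have jk : (block_min j < k)%N.
  rewrite ltn_neqAle jb andbT; apply: contraNneq ne => E.
  by rewrite -mm; apply/eqP; congr block_min; exact: val_inj.
have ki : (k < j)%N.
  rewrite ltn_neqAle bi andbT; apply: contraNneq ne => E.
  by apply/eqP; congr block_min; exact: val_inj.
case/andP: ncP => _ /(noncrossing_pblockP partP).
move/(_ _ _ _ _ kj jk ki); rewrite (same_pblock tiP mk) (same_pblock tiP mj).
rewrite !mem_pblock !coverP => /(_ isT isT)/eqP.
by rewrite -block_min_eq (negPf ne).
Qed.

End MinLabels.

(** * Counting outer singletons *)

Definition straddled n (P : {set {set 'I_n}}) (v : 'I_n) : bool :=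
  [exists a : 'I_n, exists b : 'I_n, [&& (a < v)%N, (v < b)%N & b \in pblock P a]].

Definition outer_singletons n (P : {set {set 'I_n}}) : {set 'I_n} :=
  [set v : 'I_n | ([set v] \in P) && ~~ straddled P v].

Lemma outer_singleton_level n s (v : 'I_n) : size s = n -> canonical_nc s ->
  (v \in outer_singletons (level_partition n s)) = outer s v && lone s v.
Proof.
move=> sn vs; set P := level_partition n s.
have /and3P[/eqP covP tiP _] : partition P setT := level_partitionP n s.
have inP (x : 'I_n) : x \in cover P by rewrite covP in_setT.
rewrite inE; apply/andP/andP => -[].
  move=> Pv /existsP nstr.
  have E (i : 'I_n) : nth 0 s i = nth 0 s v -> i = v.
    move=> iv; apply/set1P; rewrite -(def_pblock tiP Pv (set11 v)).
    by rewrite mem_level_pblock iv.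
  have [v1 v2 _] := vs v (leq_trans (ltn_ord v) (eq_leq (esym sn))).
  have sv : nth 0 s v = v.
    have := E (Ordinal (leq_ltn_trans v1 (ltn_ord v))) v2.
    by move/(congr1 val).
  split.
    apply/outerP; split=> //; first by rewrite sn.
    (* If s_b < v, the points s_b and b of one block would straddle v. *)
    move=> b /andP[vb bs]; rewrite leqNgt; apply/negP => bv; apply: nstr.
    have b_n : (b < n)%N by rewrite -sn.
    have [b1 b2 _] := vs b bs.
    exists (Ordinal (ltn_trans bv (ltn_ord v))).
    apply/existsP; exists (Ordinal b_n); rewrite mem_level_pblock /= bv b2 eqxx.
    rewrite andbT ltn_neqAle vb andbT; apply: contraTneq bv => <-.
    by rewrite sv ltnn.
  apply/negP => /(nthP 0) [i]; rewrite size_drop nth_drop => i_lt si.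
  have j_n : (v.+1 + i < n)%N by move: i_lt; rewrite sn ltn_subRL.
  have := E (Ordinal j_n); rewrite sv /= => /(_ si)/(congr1 val) /=; lia.
move=> /outerP[_ sv H] lv; split.
  rewrite (_ : [set v] = pblock P v) ?pblock_mem //.
  apply/setP => i; rewrite inE mem_level_pblock sv.
  apply/eqP/eqP => [->//|vi]; apply/val_inj/eqP; rewrite eqn_leq /=.
  have [i1 _ _] := vs i (leq_trans (ltn_ord i) (eq_leq (esym sn))).
  rewrite -vi in i1; rewrite i1 andbT leqNgt; apply: contra lv => vi'.
  apply/(nthP 0); exists (i - v.+1)%N; last by rewrite nth_drop subnKC.
  by rewrite size_drop sn ltn_sub2r // (leq_ltn_trans vi').
apply/existsP => -[a /existsP[b /and3P[av vb]]]; rewrite mem_level_pblock => /eqP ab.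
have := H b; rewrite -ab (ltnW vb) sn ltn_ord => /(_ isT); apply/negP.
have [a1 _ _] := vs a (leq_trans (ltn_ord a) (eq_leq (esym sn))).
by rewrite -ltnNge; exact: leq_ltn_trans av.
Qed.

Lemma card_outer_singletons_level n s : size s = n -> canonical_nc s ->
  #|outer_singletons (level_partition n s)| = count_mem true (outer_word s).
Proof.
move=> sn vs; rewrite count_map count_filter count_rev sn.
rewrite -sum1_card (eq_bigl (fun v : 'I_n => outer s v && lone s v)) => [|v].
  rewrite -(big_mkord (fun v => outer s v && lone s v) (fun=> 1%N)) sum1_count.
  by rewrite /index_iota subn0; apply: eq_count => v /=; rewrite andbC eqb_id.
exact: outer_singleton_level.
Qed.

Lemma card_nc_outer_singletons n d :
  #|[set P : {set {set 'I_n}} | noncrossing_partition P &&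
      (#|outer_singletons P| == d)]| = (\sum_(w <- words n) marked 0 d w)%N.
Proof.
rewrite -map_outer_word_ncseqs big_map /=.
pose l := [seq s <- ncseqs n | count_mem true (outer_word s) == d].
have lP s : s \in l -> [/\ size s = n, canonical_nc s &
    count_mem true (outer_word s) == d].
  by rewrite mem_filter => /andP[-> /ncseqsP[]].
have -> : (\sum_(s <- ncseqs n) (count_mem true (outer_word s) == d))%N = size l.
  by rewrite size_filter -sum1_count [RHS]big_mkcond; apply: eq_bigr => s _ /=; case: eqP.
rewrite -(size_map (level_partition n)) -(card_uniqP _); last first.
  rewrite map_inj_in_uniq ?filter_uniq ?uniq_ncseqs // => s t.
  by move=> /lP[sn vs _] /lP[tn vt _]; exact: level_partition_inj.
apply: eq_card => P; rewrite inE; apply/andP/mapP => [[ncP dP]|].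
  exists (min_labels P); last by rewrite level_partition_min_labels.
  have sP := size_min_labels P; have vP := canonical_min_labels ncP.
  rewrite mem_filter -(card_outer_singletons_level sP vP).
  by rewrite level_partition_min_labels // dP; apply/ncseqsP.
case=> s /lP[sn vs sd] ->; split; first exact: level_partition_nc.
by rewrite card_outer_singletons_level.
Qed.

(** * Visibility from the additional vertex *)

Lemma edge_pblock n (P : {set {set 'I_n}}) (a b : 'I_n) : trivIset P ->
  edge P a b -> b \in pblock P a /\ a != b.
Proof.
move=> tiP /exists_inP[B PB /and3P[aB + /eqP E]]; rewrite E => ab {E}.
split=> //.
by rewrite (def_pblock tiP PB aB) -mem_enum mem_next mem_enum.
Qed.

(** Otherwise [p] would propagate along the cycle from [x] to [y]. This yields the polygon edge
    passing over a straddled vertex. *)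
Lemma next_leaves (T : eqType) (p : pred T) (s : seq T) x y :
  uniq s -> x \in s -> y \in s -> p x -> ~~ p y ->
  exists2 z, z \in s & p z && ~~ p (next s z).
Proof.
move=> us xs ys px npy; apply/hasP; apply: contraNT npy => /hasPn H.
have : cycle (fun u v => p u ==> p v) s.
  apply: (sub_in_cycle (P := mem s)) (cycle_next us); last exact/allP.
  move=> u v us' _ /eqP <-; apply/implyP => pu.
  by move: (H u us'); rewrite pu negbK.
case/rot_to: xs => i t def_t; rewrite -(rot_cycle i) def_t /=.
rewrite rcons_path => /andP[/order_path_min H' _].
move: ys; rewrite -(mem_rot i) def_t inE => /orP[/eqP -> //|yt].
have /allP/(_ _ yt) : all (fun v => p x ==> p v) t.
  by apply: H' => u v w /implyP uv /implyP vw; apply/implyP => /uv.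
by rewrite px.
Qed.

Section Visibility.

Variables (R : realFieldType) (n : nat).
Variable p : 'I_n.+1 -> 'rV[R]_2.
Hypothesis hccw : ccw_labelled p.

Let q (i : 'I_n) := p (widen_ord (leqnSn n) i).

Lemma orient_affine (a b x y : 'rV[R]_2) t :
  orient a b ((1 - t) *: x + t *: y) = (1 - t) * orient a b x + t * orient a b y.
Proof. by rewrite /orient !mxE; ring. Qed.

Lemma orient_rot (a b c : 'rV[R]_2) : orient b c a = orient a b c.
Proof. by rewrite /orient; ring. Qed.

Lemma orient_swap (a b c : 'rV[R]_2) : orient b a c = - orient a b c.
Proof. by rewrite /orient; ring. Qed.

Lemma orient_open_segment (a b z : 'rV[R]_2) : open_segment a b z -> orient a b z = 0.
Proof. by case=> t _ ->; rewrite orient_affine /orient; ring. Qed.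

(** The parameters of the common point are ratios of triangle areas; [E] compares the two
    triangulations of the quadrilateral. *)
Lemma quadrilateral_diagonals_meet (a b c d : 'rV[R]_2) :
  0 < orient a b c -> 0 < orient a c d -> 0 < orient b c d -> 0 < orient a b d ->
  exists2 z, open_segment a c z & open_segment d b z.
Proof.
move=> abc acd bcd abd.
have E : orient a b c + orient a c d = orient b c d + orient a b d.
  by rewrite /orient; ring.
have N0 : orient a b c + orient a c d != 0 by apply: lt0r_neq0; exact: addr_gt0.
have frac (u v : R) : 0 < u -> 0 < v -> 0 < v / (u + v) < 1.
  by move=> u0 v0; rewrite divr_gt0 ?addr_gt0 //= ltr_pdivrMr ?addr_gt0 // mul1r ltrDr.
set t := orient a c d / (orient a b c + orient a c d).
exists ((1 - t) *: d + t *: b); last by exists t => //; exact: frac.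
exists (orient a b d / (orient b c d + orient a b d)); first exact: frac.
apply/rowP => k; rewrite /t -E !mxE.
apply: (mulfI N0).
have D u w (x y : R) : u != 0 ->
    u * ((1 - w / u) * x + w / u * y) = (u - w) * x + w * y.
  by move=> u0; field.
rewrite !D //.
case: k => -[|[|//]] k_lt.
- rewrite (_ : Ordinal k_lt = 0); last exact: val_inj.
  by rewrite /orient; ring.
- rewrite (_ : Ordinal k_lt = 1); last exact: val_inj.
  by rewrite /orient; ring.
Qed.

Lemma orient_pos (i j k : 'I_n) : (i < j)%N -> (j < k)%N ->
  0 < orient (q i) (q j) (q k).
Proof. by move=> ij jk; apply: hccw. Qed.

Lemma orient_last_pos (i j : 'I_n) : (i < j)%N ->
  0 < orient (q i) (q j) (p ord_max).
Proof. by move=> ij; apply: hccw => //=; exact: ltn_ord. Qed.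

(** If v is straddled, some edge cd has c < v < d, and the diagonals of the quadrilateral c, v, d,
    p_(n+1) meet. Otherwise v and p_(n+1) lie strictly on the same side of each edge, and so does
    the segment between them. *)
Lemma visible_isolated (P : {set {set 'I_n}}) (v : 'I_n) :
  partition P [set: 'I_n] -> [set v] \in P ->
  visible q P (p ord_max) (q v) <-> ~~ straddled P v.
Proof.
case/and3P => /eqP covP tiP _ Pv.
have inP (x : 'I_n) : x \in cover P by rewrite covP in_setT.
have vne (a b : 'I_n) : b \in pblock P a -> a != b -> (a != v) && (b != v).
  move=> ba ab; apply/andP; split; apply: contraNneq ab => E.
    by move: ba; rewrite E (def_pblock tiP Pv (set11 v)) inE eq_sym.
  move: (same_pblock tiP ba); rewrite E (def_pblock tiP Pv (set11 v)) => Ea.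
  by rewrite -in_set1 Ea mem_pblock.
split=> [vis|nstr].
  apply/negP => /existsP[a /existsP[b /and3P[av vb ba]]].
  have [|||||] := @next_leaves _ (fun i : 'I_n => (i < v)%N) (enum (pblock P a)) a b.
  - exact: enum_uniq.
  - by rewrite mem_enum mem_pblock.
  - by rewrite mem_enum.
  - by [].
  - by rewrite -leqNgt ltnW.
  move=> c; rewrite mem_enum => ca /andP[cv]; set d := next _ c; rewrite -leqNgt => vd.
  have da : d \in pblock P a by rewrite -mem_enum mem_next mem_enum.
  have dc : d \in pblock P c by rewrite (same_pblock tiP ca).
  have cd : c != d by rewrite neq_ltn (leq_trans cv vd).
  have /andP[_ dv] := vne _ _ dc cd.
  have {dv} vd' : (v < d)%N by rewrite ltn_neqAle vd andbT eq_sym.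
  have [z zcd [t /andP[t0 t1] zE]] := quadrilateral_diagonals_meet
    (orient_pos cv vd') (orient_last_pos (ltn_trans cv vd'))
    (orient_last_pos vd') (orient_last_pos cv).
  apply: (vis z _ c d) zcd; first by exists t => //; rewrite !ltW.
  apply/exists_inP; exists (pblock P a); first exact: pblock_mem.
  by rewrite ca cd eqxx.
move=> z [t /andP[t0 t1] zE] a b /edge_pblock -/(_ tiP) [ba ab].
move/orient_open_segment.
wlog ltab : a b ba ab / (a < b)%N.
  move=> H E; case: (ltngtP a b) => [lt|gt|/val_inj E'].
  - exact: (H a b).
  - apply: (H b a) => //; last by rewrite orient_swap E oppr0.
    + by rewrite (same_pblock tiP ba) mem_pblock.
    + by rewrite eq_sym.
  - by rewrite E' eqxx in ab.
have /andP[av bv] := vne _ _ ba ab.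
rewrite zE orient_affine; apply/eqP; rewrite gt_eqF //.
have e_pos := orient_last_pos ltab.
have v_pos : 0 < orient (q a) (q b) (q v).
  have [va|av'|/val_inj E] := ltngtP v a.
  - by rewrite orient_rot; exact: orient_pos.
  - have [vb|bv'|/val_inj E] := ltngtP v b.
    + case/negP: nstr; apply/existsP; exists a; apply/existsP; exists b.
      by rewrite av' vb.
    + exact: orient_pos.
    + by rewrite E eqxx in bv.
  - by rewrite E eqxx in av.
have [->|tn0] := eqVneq t 0; first by rewrite subr0 mul1r mul0r addr0.
apply: ltr_wpDl; first by apply: mulr_ge0; [rewrite subr_ge0|exact: ltW].
by apply: mulr_gt0; rewrite // lt_def tn0.
Qed.

Lemma isolation_degree_outer_singletons (P : {set {set 'I_n}}) :
  partition P [set: 'I_n] -> isolation_degree p P = #|outer_singletons P|.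
Proof.
move=> partP; apply: eq_card => v; rewrite !inE.
case: (boolP ([set v] \in P)) => //= Pv.
by apply/asboolP/idP => /(visible_isolated partP Pv).
Qed.

End Visibility.

Theorem theorem16 (R : realFieldType) (n : nat) (hn : (1 <= n)%N)
    (p : 'I_n.+1 -> 'rV[R]_2) (hconv : convex_position p)
    (hccw : ccw_labelled p) (j : nat) (hj : (1 <= j <= n.+1)%N) :
  (num_isolation_degree p (j - 1))%:R =
    j%:R / n.+1%:R *
    \sum_(uphalf (n + j + 1) <= k < n.+2)
      'C(n.+1, k)%:R * gbinomial (k%:Z - j%:Z - 1) (2 * k - n - j - 1)
        * 2%:R ^+ (2 * k - n - j - 1) :> rat.
Proof.
(* Truncation at K = n + 2 leaves all coefficients up to degree n + 1 exact. *)
rewrite -(motzkin_coef_explicit (leqnn n.+2) hj) -sum_marked_words //.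
rewrite -card_nc_outer_singletons; congr _%:R; apply: eq_card => P; rewrite !inE.
case: (boolP (noncrossing_partition P)) => //= /andP[partP _].
by rewrite (isolation_degree_outer_singletons hccw).
Qed.
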